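(* Let $n\ge 3$, let $\tau=(\tau_{ij})$ be an antisymmetric $n\times n$ real matrix, let $\sigma=(\sigma_{ij})$ be a real matrix whose antisymmetrization is $\tau$, and let $\star$ be the Moyal-Weyl product on $\mathbb R[x_1,\dots,x_n]$ given by $$f\star g=\sum_{r\in\mathbb N}\ \sum_{1\le i_1,j_1,\dots,i_r,j_r\le n}\sigma_{i_1j_1}\cdots\sigma_{i_rj_r}\,\frac{\partial^r f}{\partial x_{i_1}\cdots\partial x_{i_r}}\,\frac{\partial^r g}{\partial x_{j_1}\cdots\partial x_{j_r}}\,\frac{t^r}{r!}.$$ For $r\in\mathbb N$ and indices $i_1,j_1,\dots,i_r,j_r\in\{1,\dots,n\}$ let $$\mu_r(f,g)=\mu_r^{(i_1,\dots,i_r;\,j_1,\dots,j_r)}(f,g)=\frac{\partial^r f}{\partial x_{i_1}\cdots\partial x_{i_r}}\,\frac{\partial^r g}{\partial x_{j_1}\cdots\partial x_{j_r}}.$$ The only morphisms $\alpha:\mathbb R[x_1,\dots,x_n]\to\mathbb R[x_1,\dots,x_n]$ satisfying $\alpha\circ\mu_r=\mu_r\circ\alpha^{\otimes2}$ for all $r\in\mathbb N$ (and all choices of indices) which give $(\mathbb R[x_1,\dots,x_n],\ \star_\alpha=\alpha\circ\star,\ \alpha)$ a structure of Hom-associative algebra are of the form $$\forall\,1\le i\le n,\ \alpha(x_i)=x_i+b_i\qquad\text{or}\qquad\forall\,1\le i\le n,\ \alpha(x_i)=-x_i+b_i,\qquad\text{where } b_i\in\mathbb R.$$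
   Context: $\mathbb N$ includes $0$; $\mu_0$ is the usual product of polynomials. The antisymmetrization of $\sigma$ is the matrix with entries $\sigma_{ij}-\sigma_{ji}$; the associated Poisson bracket is $\{f,g\}=\sum_{i,j}\tau_{ij}\frac{\partial f}{\partial x_i}\frac{\partial g}{\partial x_j}$. A morphism $\alpha$ is a unital $\mathbb R$-algebra endomorphism of $\mathbb R[x_1,\dots,x_n]$. The maps $\star$ and $\alpha$ are extended $\mathbb R[[t]]$-linearly to $\mathbb R[x_1,\dots,x_n][[t]]$, and $f\star_\alpha g=\alpha(f\star g)$. A triple $(A,\mu,\alpha)$ with $\mu$ bilinear and $\alpha$ linear is a Hom-associative algebra if $\mu(\mu(f,g),\alpha(h))=\mu(\alpha(f),\mu(g,h))$ for all $f,g,h$. *)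

(* Defs.v *)
From HB Require Import structures.
From mathcomp Require Import all_boot all_order all_algebra.
From mathcomp Require Import reals.
From mathcomp Require Import mpoly.

Set Implicit Arguments.
Unset Strict Implicit.
Unset Printing Implicit Defensive.

Import GRing.Theory.
Local Open Scope ring_scope.

(* A formal power series in t is the sequence of its coefficients: [f k] is the
   coefficient of t^k. Series are compared coefficientwise, with [=1]. *)
Definition fps (V : Type) : Type := nat -> V.

Section FormalPowerSeries.
Variable R : comNzRingType.

Definition fps_add (V : lmodType R) (f g : fps V) : fps V :=
  fun m => f m + g m.

(* The action of R[[t]] on V[[t]] (Cauchy product). *)
Definition fps_scale (V : lmodType R) (c : fps R) (f : fps V) : fps V :=
  fun m => \sum_(i < m.+1) c i *: f (m - i)%N.

Definition fps_linear (V W : lmodType R) (F : fps V -> fps W) : Prop :=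
  (forall f g, F (fps_add f g) =1 fps_add (F f) (F g)) /\
  (forall c f, F (fps_scale c f) =1 fps_scale c (F f)).

Definition fps_bilinear (U V W : lmodType R)
    (B : fps U -> fps V -> fps W) : Prop :=
  (forall g, fps_linear (fun f => B f g)) /\ (forall f, fps_linear (B f)).

(* The R[[t]]-linear extension to V[[t]] of a linear map V -> W. *)
Definition fps_ext1 (V W : lmodType R) (F : V -> W) (f : fps V) : fps W :=
  fun m => F (f m).

(* The R[[t]]-bilinear extension of a bilinear map U * V -> W[[t]]:
   (sum_a f_a t^a, sum_b g_b t^b) is sent to sum_(a, b) B(f_a, g_b) t^(a + b). *)
Definition fps_ext2 (U V W : lmodType R) (B : U -> V -> fps W)
    (f : fps U) (g : fps V) : fps W :=
  fun m => \sum_(a < m.+1) \sum_(b < m.+1) \sum_(r < m.+1 | (a + b + r == m)%N)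
             B (f a) (g b) r.

(* Hom-associative algebra structures over R[[t]] on V[[t]]. *)
Definition hom_associative (V : lmodType R)
    (mu : fps V -> fps V -> fps V) (alpha : fps V -> fps V) : Prop :=
  [/\ fps_bilinear mu,
      fps_linear alpha
    & forall f g h, mu (mu f g) (alpha h) =1 mu (alpha f) (mu g h)].

End FormalPowerSeries.

Section MoyalWeyl.
Variables (R : realType) (n : nat).

Definition mu_r (r : nat) (I J : r.-tuple 'I_n) (f g : {mpoly R[n]}) :
    {mpoly R[n]} :=
  foldr (@mderiv n R) f I * foldr (@mderiv n R) g J.

Definition moyal_poly (sigma : 'M[R]_n) (f g : {mpoly R[n]}) :
    fps {mpoly R[n]} :=
  fun r => \sum_(I : r.-tuple 'I_n) \sum_(J : r.-tuple 'I_n)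
             ((\prod_(k < r) sigma (tnth I k) (tnth J k)) / r`!%:R) *:
               mu_r I J f g.

Definition moyal (sigma : 'M[R]_n) :
    fps {mpoly R[n]} -> fps {mpoly R[n]} -> fps {mpoly R[n]} :=
  fps_ext2 (moyal_poly sigma).

Definition moyal_twist (sigma : 'M[R]_n) (alpha : {mpoly R[n]} -> {mpoly R[n]})
    (f g : fps {mpoly R[n]}) : fps {mpoly R[n]} :=
  fps_ext1 alpha (moyal sigma f g).

End MoyalWeyl.

(* Main.v *)
(* Necessity uses only the compatibility with the mu_r for r = 1: on coordinate
   functions it reads d_i(alpha x_k) d_j(alpha x_l) = delta_ik delta_jl, so the
   Jacobian matrix of alpha is s * 1 with s^2 = 1. Conversely, if
   alpha x_i = s x_i + b_i with s = 1 or -1, then d_i o alpha = s alpha o d_i and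
   the signs cancel in mu_r; hence alpha is multiplicative for the star product,
   and Hom-associativity becomes alpha^2 applied to the associativity of the star
   product. The latter holds in degree k + 1 because both bracketings satisfy the
   same recursion (the derivative in t), which gives (k + 1) times the
   coefficient of t^(k+1) in terms of coefficients of t^k. *)
Require Import Defs.
From HB Require Import structures.
From mathcomp Require Import all_boot all_order all_algebra.
From mathcomp Require Import reals.
From mathcomp Require Import mpoly.

Set Implicit Arguments.
Unset Strict Implicit.

Import GRing.Theory.
Local Open Scope ring_scope.

(** * Finite sums constrained by indicators of the total degree *)

Section IversonSums.
Variable V : zmodType.

Lemma big_ord_widen_supp (F : nat -> V) (m N : nat) : (m < N)%N ->
    (forall i, (m < i)%N -> F i = 0) ->
  \sum_(i < m.+1) F i = \sum_(i < N) F i.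
Proof.
move=> mN F0; rewrite (big_ord_widen N F mN) big_mkcond /=.
by apply: eq_bigr => i _; rewrite ltnS; case: leqP => // /F0 ->.
Qed.

(** Eliminates an index [a] that only names an intermediate degree [s]. If [s] lies outside the
    range, then [s >= N > m], so the right side vanishes as well. *)
Lemma sum_Iverson_collapse (N m s t : nat) (x : V) : (m < N)%N ->
  \sum_(a < N) (x *+ (s == a)%N) *+ (a + t == m)%N = x *+ (s + t == m)%N.
Proof.
move=> mN; case: (ltnP s N) => sN.
  rewrite (bigD1 (Ordinal sN)) //= eqxx big1 ?addr0 // => a ne.
  suff -> : (s == a) = false by rewrite mul0rn.
  by apply: contraNF ne => /eqP e; apply/eqP/val_inj.
rewrite big1; last first.
  move=> a _; suff -> : (s == a) = false by rewrite mul0rn.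
  by apply: gtn_eqF; apply: leq_trans sN.
have -> : (s + t == m)%N = false; last by [].
by apply: gtn_eqF; apply: leq_trans mN (leq_trans sN (leq_addr _ _)).
Qed.

(** The indicator leaves degree [m - s] to share between [p] and [q], so [p] determines [q]. The
    factor on the right handles [s > m], where truncated subtraction would leave a spurious term. *)
Lemma sum_Iverson_diag (N m s : nat) (X : nat -> nat -> V) : (m < N)%N ->
  \sum_(p < N) \sum_(q < N) X p q *+ (s + (p + q) == m)%N =
  (\sum_(p < (m - s).+1) X p (m - s - p)%N) *+ (s <= m)%N.
Proof.
move=> mN; case: (leqP s m) => sm; last first.
  rewrite big1 // => p _; rewrite big1 // => q _.
  by rewrite (gtn_eqF (leq_trans sm (leq_addr _ _))).
have kN : (m - s < N)%N by apply: leq_ltn_trans (leq_subr _ _) mN.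
have -> : \sum_(p < (m - s).+1) X p (m - s - p)%N =
          \sum_(p < (m - s).+1) X p (m - s - p)%N *+ (p <= m - s)%N.
  by apply: eq_bigr => p _; rewrite -ltnS ltn_ord.
rewrite mulr1n.
rewrite (@big_ord_widen_supp (fun p => X p (m - s - p)%N *+ (p <= m - s)%N) _ N)
  //; last by move=> i; rewrite ltnNge => /negPf ->.
apply: eq_bigr => p _.
have E q : (s + (p + q) == m)%N = (p + q == m - s)%N.
  by rewrite -{1}(subnKC sm) eqn_add2l.
case: leqP => pk; last first.
  by rewrite big1 // => q _; rewrite E (gtn_eqF (leq_trans pk (leq_addr _ _))).
have qN : (m - s - p < N)%N by apply: leq_ltn_trans (leq_subr _ _) kN.
rewrite (bigD1 (Ordinal qN)) //= E subnKC // eqxx big1 ?addr0 // => q ne.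
rewrite E; suff -> : (p + q == m - s)%N = false by [].
apply: contraNF ne => /eqP e; apply/eqP/val_inj => /=.
by rewrite -e addKn.
Qed.

End IversonSums.

(** * Linearity and associativity of extensions to formal power series *)

Section FormalPowerSeries.
Variable R : comNzRingType.

(** With indicators over a box of any size [N > m], the ranges no longer depend on [m] or on each
    other, so nested sums can be exchanged freely. [fps_ext2E] serves the same purpose. *)
Lemma fps_scaleE (V : lmodType R) (c : fps R) (f : fps V) (N m : nat) :
  (m < N)%N ->
  fps_scale c f m = \sum_(i < N) \sum_(j < N) (c i *: f j) *+ (i + j == m)%N.
Proof.
by move=> mN; rewrite (@sum_Iverson_diag _ N m 0 (fun i j => c i *: f j)) // subn0.
Qed.

Lemma fps_ext2E (U V W : lmodType R) (B : U -> V -> fps W) f g (N m : nat) :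
  (m < N)%N ->
  fps_ext2 B f g m =
  \sum_(a < N) \sum_(b < N) \sum_(r < N) B (f a) (g b) r *+ (a + b + r == m)%N.
Proof.
move=> mN; rewrite /fps_ext2.
pose T a b r := B (f a) (g b) r *+ (a + b + r == m)%N.
have T0 a b r : (m < a + b + r)%N -> T a b r = 0.
  by move=> lt; rewrite /T (gtn_eqF lt).
rewrite -(@big_ord_widen_supp _
  (fun a => \sum_(b < N) \sum_(r < N) T a b r) _ _ mN); last first.
  move=> a lt; rewrite big1 // => b _; rewrite big1 // => r _.
  by apply: T0; rewrite -addnA; apply: leq_trans lt (leq_addr _ _).
apply: eq_bigr => a _.
rewrite -(@big_ord_widen_supp _ (fun b => \sum_(r < N) T a b r) _ _ mN);
  last first.
  move=> b lt; rewrite big1 // => r _.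
  by apply: T0; rewrite addnAC; apply: leq_trans lt (leq_addl _ _).
apply: eq_bigr => b _.
rewrite -(@big_ord_widen_supp _ (T a b) _ _ mN); last first.
  by move=> r lt; apply: T0; apply: leq_trans lt (leq_addl _ _).
by rewrite big_mkcond; apply: eq_bigr => r _; rewrite /T mulrb.
Qed.

(** Reduces linearity in the right argument to linearity in the left one. *)
Lemma fps_ext2C (U V W : lmodType R) (B : U -> V -> fps W) f g :
  fps_ext2 B f g =1 fps_ext2 (fun v u => B u v) g f.
Proof.
move=> m; rewrite !(@fps_ext2E _ _ _ _ _ _ m.+1) // exchange_big.
do 3![apply: eq_bigr => ? _]; by rewrite [X in (X + _)%N]addnC.
Qed.

Lemma fps_ext1_linear (V W : lmodType R) (F : {linear V -> W}) :
  fps_linear (fps_ext1 F).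
Proof.
split=> [f g m | c f m]; first by rewrite /fps_ext1 /fps_add linearD.
rewrite /fps_ext1 /fps_scale linear_sum.
by apply: eq_bigr => i _; rewrite linearZ.
Qed.

(** Bundles the maps as linear ones, so that the generic rewriting rules for linear maps apply to
    them. *)
Lemma linear_family (S T : Type) (U V : lmodType R) (F : U -> S -> T -> V) :
    (forall s t, linear (fun u => F u s t)) ->
  exists L : S -> T -> {linear U -> V}, forall u s t, F u s t = L s t u.
Proof.
move=> Fl.
pose L s t : {linear U -> V} := HB.pack (fun u => F u s t)
  (GRing.isLinear.Build R U V *:%R (fun u => F u s t) (Fl s t)).
by exists L.
Qed.

Lemma fps_ext2_linearl (U V W : lmodType R) (B : U -> V -> fps W)
    (Bl : forall v r, linear (fun u => B u v r)) (g : fps V) :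
  fps_linear (fun f => fps_ext2 B f g).
Proof.
have [L E] := linear_family Bl.
split=> [f f' m | c f m].
  rewrite /fps_add /fps_ext2 -big_split; apply: eq_bigr => a _.
  rewrite -big_split; apply: eq_bigr => b _; rewrite -big_split.
  by apply: eq_bigr => r _; rewrite !E linearD.
rewrite (@fps_ext2E _ _ _ _ _ _ m.+1) // (@fps_scaleE _ _ _ m.+1) //.
(* Normal form of both sides: [i], [j], [b] are the degrees taken from [c], [f], [g], and [r] is the
   degree produced by [B]. *)
transitivity (\sum_(i < m.+1) \sum_(j < m.+1) \sum_(b < m.+1) \sum_(r < m.+1)
    (c i *: B (f j) (g b) r) *+ (i + j + (b + r) == m)%N); last first.
  apply: eq_bigr => i _.
  have X (k : 'I_m.+1) : (c i *: fps_ext2 B f g k) *+ (i + k == m)%N =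
    \sum_(j < m.+1) \sum_(b < m.+1) \sum_(r < m.+1)
      ((c i *: B (f j) (g b) r) *+ (j + b + r == k)%N) *+ (k + i == m)%N.
    rewrite (@fps_ext2E _ _ _ _ _ _ m.+1) // addnC scaler_sumr -sumrMnl.
    apply: eq_bigr => j _; rewrite scaler_sumr -sumrMnl.
    apply: eq_bigr => b _; rewrite scaler_sumr -sumrMnl.
    by apply: eq_bigr => r _; rewrite scalerMnr.
  rewrite (eq_bigr _ (fun k _ => X k)) [RHS]exchange_big.
  apply: eq_bigr => j _; rewrite [RHS]exchange_big; apply: eq_bigr => b _.
  rewrite [RHS]exchange_big; apply: eq_bigr => r _.
  by rewrite sum_Iverson_collapse // [(_ + i)%N]addnC !addnA.
(* Here [a] is the degree in the scaled series; it is eliminated last. *)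
transitivity (\sum_(a < m.+1) \sum_(i < m.+1) \sum_(j < m.+1) \sum_(b < m.+1)
    \sum_(r < m.+1)
    ((c i *: B (f j) (g b) r) *+ (i + j == a)%N) *+ (a + (b + r) == m)%N).
  apply: eq_bigr => a _.
  under eq_bigr => b _ do under eq_bigr => r _ do
    rewrite E (@fps_scaleE _ _ _ m.+1) // linear_sum -sumrMnl.
  under eq_bigr => b _ do rewrite exchange_big.
  rewrite exchange_big; apply: eq_bigr => i _.
  under eq_bigr => b _ do under eq_bigr => r _ do rewrite linear_sum -sumrMnl.
  under eq_bigr => b _ do rewrite exchange_big.
  rewrite exchange_big; apply: eq_bigr => j _.
  by do 2![apply: eq_bigr => ? _]; rewrite linearMn linearZ -E addnA.
rewrite exchange_big; apply: eq_bigr => i _.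
rewrite exchange_big; apply: eq_bigr => j _.
rewrite exchange_big; apply: eq_bigr => b _.
rewrite exchange_big; apply: eq_bigr => r _.
by rewrite sum_Iverson_collapse.
Qed.

(** Series are compared coefficientwise, so linearity has to be transported explicitly along such
    equalities. *)
Lemma eq_fps_linear (V W : lmodType R) (F G : fps V -> fps W) :
  (forall f, F f =1 G f) -> fps_linear F -> fps_linear G.
Proof.
move=> E [FD FZ]; split=> [f g m | c f m]; first by rewrite -E FD /fps_add !E.
by rewrite -E FZ /fps_scale; apply: eq_bigr => i _; rewrite E.
Qed.

Lemma fps_ext2_bilinear (U V W : lmodType R) (B : U -> V -> fps W) :
    (forall v r, linear (fun u => B u v r)) ->
    (forall u r, linear (fun v => B u v r)) ->
  fps_bilinear (fps_ext2 B).
Proof.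
move=> Bl Br; split=> [g|f]; first exact: fps_ext2_linearl.
apply: eq_fps_linear (fps_ext2_linearl Br f) => g m.
by rewrite -fps_ext2C.
Qed.

(** Linearity of [G] is a coefficientwise equality, so [F] is asked to respect such equalities. *)
Lemma fps_linear_comp (U V W : lmodType R) (F : fps V -> fps W)
    (G : fps U -> fps V) :
    (forall f g, f =1 g -> F f =1 F g) ->
  fps_linear F -> fps_linear G -> fps_linear (fun f => F (G f)).
Proof.
move=> Fc [FD FZ] [GD GZ].
by split=> [f g m | c f m]; [rewrite (Fc _ _ (GD f g)) FD | rewrite (Fc _ _ (GZ c f)) FZ].
Qed.

(** Both bracketings are sums over the degrees [a], [b], [c] of the arguments and [p], [q] of the
    inner and outer products, of total [m]. For fixed [a], [b], [c] the remaining sum over [p] and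
    [q] is the one in the hypothesis. *)
Lemma fps_ext2_assoc (V : lmodType R) (B : V -> V -> fps V)
    (Bl : forall v r, linear (fun u => B u v r))
    (Br : forall u r, linear (fun v => B u v r)) :
    (forall f g h k, \sum_(p < k.+1) B (B f g p) h (k - p)%N =
                     \sum_(p < k.+1) B f (B g h p) (k - p)%N) ->
  forall f g h, fps_ext2 B (fps_ext2 B f g) h =1 fps_ext2 B f (fps_ext2 B g h).
Proof.
move=> BA f g h m.
have [L E] := linear_family Bl.
have [L' E'] := @linear_family _ _ _ _ (fun v u r => B u v r) Br.
transitivity (\sum_(a < m.+1) \sum_(b < m.+1) \sum_(c < m.+1)
    \sum_(p < m.+1) \sum_(q < m.+1)
     B (B (f a) (g b) p) (h c) q *+ (a + b + c + (p + q) == m)%N).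
  rewrite (@fps_ext2E _ _ _ _ _ _ m.+1) //.
  transitivity (\sum_(s < m.+1) \sum_(a < m.+1) \sum_(b < m.+1) \sum_(c < m.+1)
    \sum_(p < m.+1) \sum_(q < m.+1)
     (B (B (f a) (g b) p) (h c) q *+ (a + b + p == s)%N) *+ (s + (c + q) == m)%N).
    apply: eq_bigr => s _.
    under eq_bigr => c _ do under eq_bigr => q _ do
      rewrite (@fps_ext2E _ _ _ _ _ _ m.+1) // E linear_sum -sumrMnl.
    under eq_bigr => c _ do rewrite exchange_big.
    rewrite exchange_big; apply: eq_bigr => a _.
    under eq_bigr => c _ do under eq_bigr => q _ do rewrite linear_sum -sumrMnl.
    under eq_bigr => c _ do rewrite exchange_big.
    rewrite exchange_big; apply: eq_bigr => b _.
    apply: eq_bigr => c _.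
    under eq_bigr => q _ do rewrite linear_sum -sumrMnl.
    rewrite exchange_big.
    by do 2![apply: eq_bigr => ? _]; rewrite linearMn -E addnA.
  rewrite exchange_big; apply: eq_bigr => a _.
  rewrite exchange_big; apply: eq_bigr => b _.
  rewrite exchange_big; apply: eq_bigr => c _.
  rewrite exchange_big; apply: eq_bigr => p _.
  rewrite exchange_big; apply: eq_bigr => q _.
  by rewrite sum_Iverson_collapse // addnACA !addnA.
(* The reassociation takes place between the two normal forms; what follows is the expansion of the
   right bracketing. *)
transitivity (\sum_(a < m.+1) \sum_(b < m.+1) \sum_(c < m.+1)
    \sum_(p < m.+1) \sum_(q < m.+1)
     B (f a) (B (g b) (h c) p) q *+ (a + b + c + (p + q) == m)%N).
  do 3![apply: eq_bigr => ? _].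
  rewrite (@sum_Iverson_diag _ _ _ _ (fun p q => B (B (f _) (g _) p) (h _) q)) //.
  by rewrite (@sum_Iverson_diag _ _ _ _ (fun p q => B (f _) (B (g _) (h _) p) q)) // BA.
rewrite [RHS](@fps_ext2E _ _ _ _ _ _ m.+1) //; apply: eq_bigr => a _.
transitivity (\sum_(s < m.+1) \sum_(b < m.+1) \sum_(c < m.+1)
    \sum_(p < m.+1) \sum_(q < m.+1)
     (B (f a) (B (g b) (h c) p) q *+ (b + c + p == s)%N) *+ (s + (a + q) == m)%N).
  rewrite [RHS]exchange_big; apply: eq_bigr => b _.
  rewrite [RHS]exchange_big; apply: eq_bigr => c _.
  rewrite [RHS]exchange_big; apply: eq_bigr => p _.
  rewrite [RHS]exchange_big; apply: eq_bigr => q _.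
  by rewrite sum_Iverson_collapse // [in RHS]addnACA [(b + c + a)%N]addnC !addnA.
apply: eq_bigr => s _.
under [RHS]eq_bigr => q _ do
  rewrite (@fps_ext2E _ _ _ _ _ _ m.+1) // E' linear_sum -sumrMnl.
rewrite [RHS]exchange_big; apply: eq_bigr => b _.
under [RHS]eq_bigr => q _ do rewrite linear_sum -sumrMnl.
rewrite [RHS]exchange_big; apply: eq_bigr => c _.
under [RHS]eq_bigr => q _ do rewrite linear_sum -sumrMnl.
rewrite [RHS]exchange_big; apply: eq_bigr => p _.
by apply: eq_bigr => q _; rewrite linearMn -E' addnA [(a + s)%N]addnC.
Qed.

End FormalPowerSeries.

(** * The Moyal-Weyl product: recursion in the degree, associativity and twisting *)

Section MoyalProduct.
Variables (R : realType) (n : nat).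
Implicit Types (sigma : 'M[R]_n) (f g h : {mpoly R[n]}).

Lemma big_tuple_cons (V : nmodType) (T : finType) r
    (F : r.+1.-tuple T -> V) :
  \sum_(t : r.+1.-tuple T) F t = \sum_(x : T) \sum_(t : r.-tuple T) F [tuple of x :: t].
Proof.
rewrite pair_big /= (reindex (fun p : T * r.-tuple T => [tuple of p.1 :: p.2])) //.
exists (fun t => (thead t, [tuple of behead t])) => [[x t] _|t _] /=.
  by congr (_, _); apply: val_inj.
by rewrite -tuple_eta.
Qed.

Lemma foldr_mderiv_mderiv (i : 'I_n) (I : seq 'I_n) f :
  (foldr (@mderiv n R) f I)^`M(i) = foldr (@mderiv n R) f^`M(i) I.
Proof. by elim: I => //= j I <-; rewrite mderiv_comm. Qed.

Lemma moyal_poly0 sigma f g : moyal_poly sigma f g 0 = f * g.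
Proof.
rewrite /moyal_poly (big_pred1 [tuple]) => [|t]; last by apply/esym/eqP/tuple0.
rewrite (big_pred1 [tuple]) => [|t]; last by apply/esym/eqP/tuple0.
by rewrite big_ord0 fact0 divr1 scale1r.
Qed.

(** Coefficient form of the t-derivative of the exponential of [t] times the sum of the [sigma i j]
    d_i (x) d_j. The first index pair is split off, and the factor [r.+1] turns [r.+1]! into
    [r]!. *)
Lemma moyal_polyS sigma f g r :
  moyal_poly sigma f g r.+1 *+ r.+1 =
  \sum_(i < n) \sum_(j < n) sigma i j *: moyal_poly sigma f^`M(i) g^`M(j) r.
Proof.
rewrite /moyal_poly big_tuple_cons.
rewrite -sumrMnl; apply: eq_bigr => i _.
under eq_bigr => I _ do rewrite big_tuple_cons.
rewrite exchange_big -sumrMnl; apply: eq_bigr => j _.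
rewrite scaler_sumr -sumrMnl; apply: eq_bigr => I _.
rewrite scaler_sumr -sumrMnl; apply: eq_bigr => J _.
rewrite big_ord_recl !(tnth0) scalerA /mu_r /= !foldr_mderiv_mderiv.
rewrite -scaler_nat scalerA; congr (_ *: _).
under eq_bigr => k _ do rewrite !tnthS.
rewrite factS natrM invfM mulrCA -!mulrA; congr (_ * (_ * _)).
by rewrite mulrA mulfV ?mul1r // Num.Theory.pnatr_eq0.
Qed.

(** Solved for the next coefficient, the recursion drives the inductions on [r] below. *)
Lemma moyal_polySE sigma f g r :
  moyal_poly sigma f g r.+1 = r.+1%:R^-1 *:
  \sum_(i < n) \sum_(j < n) sigma i j *: moyal_poly sigma f^`M(i) g^`M(j) r.
Proof.
rewrite -moyal_polyS -scaler_nat scalerA mulVf ?scale1r //.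
by rewrite Num.Theory.pnatr_eq0.
Qed.

Lemma moyal_poly_linearl sigma g r :
  linear (fun f => moyal_poly sigma f g r).
Proof.
elim: r g => [|r IH] g c f f'; first by rewrite !moyal_poly0 mulrDl scalerAl.
rewrite !moyal_polySE scalerA mulrC -scalerA -scalerDr; congr (_ *: _).
rewrite scaler_sumr -big_split; apply: eq_bigr => i _.
rewrite scaler_sumr -big_split; apply: eq_bigr => j _ /=.
by rewrite linearP IH scalerDr !scalerA mulrC.
Qed.

Lemma moyal_poly_linearr sigma f r : linear (fun g => moyal_poly sigma f g r).
Proof.
elim: r f => [|r IH] f c g g'; first by rewrite !moyal_poly0 mulrDr scalerAr.
rewrite !moyal_polySE scalerA mulrC -scalerA -scalerDr; congr (_ *: _).
rewrite scaler_sumr -big_split; apply: eq_bigr => i _.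
rewrite scaler_sumr -big_split; apply: eq_bigr => j _ /=.
by rewrite linearP IH scalerDr !scalerA mulrC.
Qed.

(** The Leibniz rule for the ordinary product passes through the recursion because partial
    derivatives commute. *)
Lemma mderiv_moyal_poly sigma f g r (i : 'I_n) :
  (moyal_poly sigma f g r)^`M(i) =
  moyal_poly sigma f^`M(i) g r + moyal_poly sigma f g^`M(i) r.
Proof.
elim: r f g => [|r IH] f g; first by rewrite !moyal_poly0 mderivM.
rewrite !moyal_polySE linearZ -scalerDr; congr (_ *: _).
rewrite linear_sum -big_split; apply: eq_bigr => j _ /=.
rewrite linear_sum -big_split; apply: eq_bigr => k _ /=.
by rewrite linearZ -scalerDr /= IH (mderiv_comm j i) (mderiv_comm k i).
Qed.

(** The coefficient of t^k in the left-bracketed star product of three polynomials; [moyal_tripler]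
    is the right-bracketed one. *)
Definition moyal_triplel sigma f g h k :=
  \sum_(p < k.+1) moyal_poly sigma (moyal_poly sigma f g p) h (k - p)%N.

Definition moyal_tripler sigma f g h k :=
  \sum_(p < k.+1) moyal_poly sigma f (moyal_poly sigma g h p) (k - p)%N.

(** Product rule in t: on each term [k.+1] is split as the sum of its two degrees. Each half loses
    the term where its multiplicity is zero and is then reindexed. *)
Lemma mulrn_sum_antidiagonal (V : zmodType) (T : nat -> nat -> V) k :
  (\sum_(p < k.+2) T p (k.+1 - p)%N) *+ k.+1 =
  \sum_(p < k.+1) (T p.+1 (k - p)%N *+ p.+1 + T p (k - p).+1 *+ (k - p).+1).
Proof.
rewrite -sumrMnl big_split /=.
transitivity (\sum_(p < k.+2) (T p (k.+1 - p)%N *+ p +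
                               T p (k.+1 - p)%N *+ (k.+1 - p))).
  by apply: eq_bigr => p _; rewrite -mulrnDr subnKC // -ltnS.
rewrite big_split /=; congr (_ + _).
  by rewrite big_ord_recl mulr0n add0r; apply: eq_bigr.
rewrite big_ord_recr /= subnn mulr0n addr0.
by apply: eq_bigr => p _; rewrite subSn // -ltnS.
Qed.

(* Both bracketings satisfy the recursion of the cubic operator
   exp(t (sigma_12 + sigma_13 + sigma_23)). *)
Lemma moyal_triplelS sigma f g h k :
  moyal_triplel sigma f g h k.+1 *+ k.+1 =
  \sum_(i < n) \sum_(j < n) sigma i j *:
   (moyal_triplel sigma f^`M(i) g^`M(j) h k
    + (moyal_triplel sigma f^`M(i) g h^`M(j) k
       + moyal_triplel sigma f g^`M(i) h^`M(j) k)).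
Proof.
rewrite /moyal_triplel (@mulrn_sum_antidiagonal _ (fun p q =>
  moyal_poly sigma (moyal_poly sigma f g p) h q)).
under [RHS]eq_bigr => i _ do under eq_bigr => j _ do
  rewrite -!big_split scaler_sumr.
under [RHS]eq_bigr => i _ do rewrite exchange_big.
rewrite [RHS]exchange_big; apply: eq_bigr => p _ /=.
have [L E] := linear_family (moyal_poly_linearl sigma).
(* The inner recursion gives the sigma_12 term; the outer one differentiates the inner product,
   which Leibniz splits into sigma_13 and sigma_23. *)
rewrite moyal_polyS [moyal_poly _ _ h _]E -linearMn moyal_polyS linear_sum.
rewrite -big_split; apply: eq_bigr => i _ /=; rewrite linear_sum -big_split.
apply: eq_bigr => j _ /=.
by rewrite linearZ /= mderiv_moyal_poly !E raddfD !scalerDr.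
Qed.

Lemma moyal_triplerS sigma f g h k :
  moyal_tripler sigma f g h k.+1 *+ k.+1 =
  \sum_(i < n) \sum_(j < n) sigma i j *:
   (moyal_tripler sigma f^`M(i) g^`M(j) h k
    + (moyal_tripler sigma f^`M(i) g h^`M(j) k
       + moyal_tripler sigma f g^`M(i) h^`M(j) k)).
Proof.
rewrite /moyal_tripler (@mulrn_sum_antidiagonal _ (fun p q =>
  moyal_poly sigma f (moyal_poly sigma g h p) q)).
under [RHS]eq_bigr => i _ do under eq_bigr => j _ do
  rewrite -!big_split scaler_sumr.
under [RHS]eq_bigr => i _ do rewrite exchange_big.
rewrite [RHS]exchange_big; apply: eq_bigr => p _ /=.
have [L E] := @linear_family _ _ _ _ _
  (fun g f r => moyal_poly sigma f g r) (moyal_poly_linearr sigma).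
rewrite [moyal_poly _ f _ (k - p)%N]E -linearMn !moyal_polyS linear_sum.
rewrite -big_split; apply: eq_bigr => i _ /=; rewrite linear_sum -big_split.
apply: eq_bigr => j _ /=.
(* Here the inner recursion gives sigma_23 and the outer one sigma_12 and sigma_13, hence the final
   reordering. *)
by rewrite linearZ /= mderiv_moyal_poly !E raddfD !scalerDr addrC addrA.
Qed.

Lemma moyal_triple_assoc sigma f g h k :
  moyal_triplel sigma f g h k = moyal_tripler sigma f g h k.
Proof.
elim: k f g h => [|k IH] f g h.
  by rewrite /moyal_triplel /moyal_tripler !big_ord1 !moyal_poly0 mulrA.
have k0 : k.+1%:R != 0 :> R by rewrite Num.Theory.pnatr_eq0.
apply: (scalerI k0); rewrite !scaler_nat moyal_triplelS moyal_triplerS.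
by do 2![apply: eq_bigr => ? _]; rewrite !IH.
Qed.

Lemma moyal_assoc sigma (f g h : fps {mpoly R[n]}) :
  moyal sigma (moyal sigma f g) h =1 moyal sigma f (moyal sigma g h).
Proof.
apply: fps_ext2_assoc; [exact: moyal_poly_linearl|exact: moyal_poly_linearr|].
exact: moyal_triple_assoc.
Qed.

Lemma moyal_bilinear sigma : fps_bilinear (moyal sigma).
Proof.
by apply: fps_ext2_bilinear => *; [exact: moyal_poly_linearl|exact: moyal_poly_linearr].
Qed.

Lemma hom_associative_moyal_twist sigma
    (alpha : {linear {mpoly R[n]} -> {mpoly R[n]}}) :
    (forall r (I J : r.-tuple 'I_n) f g,
       alpha (mu_r I J f g) = mu_r I J (alpha f) (alpha g)) ->
  hom_associative (moyal_twist sigma alpha) (fps_ext1 alpha).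
Proof.
move=> alpha_mu.
have alpha_moyal (f g : fps {mpoly R[n]}) : fps_ext1 alpha (moyal sigma f g) =1
    moyal sigma (fps_ext1 alpha f) (fps_ext1 alpha g).
  move=> m; rewrite /fps_ext1 /moyal /fps_ext2.
  do 3![rewrite linear_sum; apply: eq_bigr => ? _].
  do 2![rewrite linear_sum; apply: eq_bigr => ? _].
  by rewrite linearZ alpha_mu.
have ext1_congr (f g : fps {mpoly R[n]}) :
    f =1 g -> fps_ext1 alpha f =1 fps_ext1 alpha g.
  by move=> fg m; rewrite /fps_ext1 fg.
have [moyal_l moyal_r] := moyal_bilinear sigma.
split=> [||f g h m]; last 1 first.
- rewrite /moyal_twist /fps_ext1 -[LHS]/(alpha (moyal sigma
    (fps_ext1 alpha (moyal sigma f g)) (fps_ext1 alpha h) m)).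
  by rewrite -alpha_moyal /fps_ext1 moyal_assoc -[in LHS]/(fps_ext1 alpha _ m) alpha_moyal.
- by split=> [g|f]; apply: (fps_linear_comp ext1_congr (fps_ext1_linear alpha)).
- exact: fps_ext1_linear.
Qed.

End MoyalProduct.

(** * Endomorphisms compatible with the bidifferential operators [mu_r] *)

Section AffineSigns.
Variables (R : realType) (n : nat).
Variable alpha : {lrmorphism {mpoly R[n]} -> {mpoly R[n]}}.
Implicit Types (f g : {mpoly R[n]}).

(** If X_i divides the monomial [m], the coefficient of [m - U_(i)] in the i-th derivative is [m i]
    times that of [m] in [f], and [m i] is invertible in characteristic zero. *)
Lemma mderiv_eq0 f : (forall i, f^`M(i) = 0) -> f = (f@_0%MM)%:MP.
Proof.
move=> df; apply/mpolyP => m; rewrite mcoeffC.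
have [->|m0] := eqVneq m 0%MM; first by rewrite mulr1.
rewrite mulr0.
have [i mi] : exists i, (0 < m i)%N.
  apply/existsP; apply: contraNT m0 => /existsPn m0.
  by apply/eqP/mnmP => i; rewrite mnm0E; apply/eqP; rewrite -leqn0 leqNgt m0.
have := mcoeff_mderiv i f (m - U_(i))%MM.
rewrite df mcoeff0 submK; last by rewrite lep1mP -lt0n.
by move/esym/eqP; rewrite Num.Theory.mulrn_eq0 => /orP[//|/eqP].
Qed.

Lemma mderiv_mpolyX (i j : 'I_n) : ('X_j : {mpoly R[n]})^`M(i) = (i == j)%:R.
Proof.
rewrite mderivX mnm1E eq_sym; case: eqP => [->|_]; last by rewrite scale0r.
by rewrite -{1}[U_(j)%MM]add0m addmK mpolyX0 scale1r.
Qed.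

(** Chain rule for a substitution with Jacobian [s] times the identity. The identity is stable under
    products and linear combinations, so checking the variables suffices. *)
Lemma mderiv_sign_affine (s : R) (b : 'I_n -> R) :
    (forall i, alpha 'X_i = s *: 'X_i + (b i)%:MP) ->
  forall f i, (alpha f)^`M(i) = s *: alpha f^`M(i).
Proof.
move=> alphaX f i; pose P g := (alpha g)^`M(i) = s *: alpha g^`M(i).
have PM g h : P g -> P h -> P (g * h).
  rewrite /P => Pg Ph; rewrite rmorphM !mderivM Pg Ph rmorphD !rmorphM /=.
  by rewrite scalerDr scalerAl scalerAr.
have P1 : P 1 by rewrite /P rmorph1 -mpolyC1 mderivC rmorph0 scaler0.
elim/mpolyind: f => [|c m f _ _ IH]; first by rewrite mderiv0 rmorph0 mderiv0 scaler0.
rewrite linearP !mderivD IH !mderivZ linearP scalerDr !scalerA mulrC -scalerA.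
congr (_ *: _ + _); rewrite mpolyXE_id.
apply: (big_ind P) => // j _; elim: (m j) => [|k IHk]; first by rewrite expr0.
rewrite exprS; apply: PM => //; rewrite /P alphaX mderivD mderivC addr0 mderivZ.
by rewrite mderiv_mpolyX rmorph_nat.
Qed.

(** Each factor of [mu_r] contributes [s ^+ r], and the two powers multiply to 1. *)
Lemma sign_affine_mu_r (s : R) (b : 'I_n -> R) : s * s = 1 ->
    (forall i, alpha 'X_i = s *: 'X_i + (b i)%:MP) ->
  forall r (I J : r.-tuple 'I_n) f g,
    alpha (mu_r I J f g) = mu_r I J (alpha f) (alpha g).
Proof.
move=> ss alphaX r I J f g.
have D (K : seq 'I_n) h : foldr (@mderiv n R) (alpha h) K =
    s ^+ size K *: alpha (foldr (@mderiv n R) h K).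
  elim: K => [|i K IH] /=; first by rewrite scale1r.
  by rewrite IH mderivZ (mderiv_sign_affine alphaX) scalerA exprSr.
rewrite /mu_r !D !size_tuple rmorphM -scalerAl -scalerAr scalerA -exprMn ss.
by rewrite expr1n scale1r.
Qed.

Lemma mu_r_sign_affine :
    (forall r (I J : r.-tuple 'I_n) f g,
       alpha (mu_r I J f g) = mu_r I J (alpha f) (alpha g)) ->
  exists (b : 'I_n -> R),
    (forall i, alpha 'X_i = 'X_i + (b i)%:MP) \/
    (forall i, alpha 'X_i = - 'X_i + (b i)%:MP).
Proof.
move=> alpha_mu.
have jac (i j k l : 'I_n) : (alpha 'X_k)^`M(i) * (alpha 'X_l)^`M(j) =
    (i == k)%:R * (j == l)%:R.
  have := alpha_mu 1 [tuple i] [tuple j] 'X_k 'X_l.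
  by rewrite /mu_r /= !mderiv_mpolyX rmorphM !rmorph_nat => <-.
have [n0|n_gt0] := posnP n.
  by exists (fun=> 0); left=> i; have := ltn_ord i; rewrite {2}n0.
pose i0 := Ordinal n_gt0.
(* The square of this diagonal entry is 1 in an integral domain, so the entry is a constant 1 or
   -1. *)
have [s s1 Ds] : exists2 s : R, s = 1 \/ s = -1 & (alpha 'X_i0)^`M(i0) = s%:MP.
  have /eqP := jac i0 i0 i0 i0; rewrite !eqxx mulr1 -expr2 sqrf_eq1.
  by case/orP=> /eqP ->; [exists 1 | exists (-1)]; rewrite ?mpolyCN; auto.
have ss : s * s = 1 by case: s1 => ->; rewrite ?mulrNN mulr1.
(* Pairing any entry with the diagonal one at [i0] forces the same [s] everywhere, as [s] is its own
   inverse. *)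
have D (j l : 'I_n) : (alpha 'X_l)^`M(j) = s *: (j == l)%:R.
  have := jac i0 j i0 l; rewrite Ds eqxx mul1r mul_mpolyC => <-.
  by rewrite scalerA ss scale1r.
(* All derivatives of this difference vanish, so it equals its constant term, the sought [b i]. *)
exists (fun i => (alpha 'X_i - s *: 'X_i)@_0%MM).
have E (i : 'I_n) :
    alpha 'X_i = s *: 'X_i + ((alpha 'X_i - s *: 'X_i)@_0%MM)%:MP.
  rewrite -mderiv_eq0 ?subrKC // => j.
  by rewrite mderivB D mderivZ mderiv_mpolyX subrr.
by case: s1 E => ->; [left=> i | right=> i]; rewrite {1}E ?scale1r ?scaleN1r.
Qed.

End AffineSigns.

Theorem proposition4p10 (R : realType) (n : nat) (hn : (3 <= n)%N)
    (tau : 'M[R]_n) (htau : forall i j, tau i j = - tau j i)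
    (sigma : 'M[R]_n) (hsigma : forall i j, tau i j = sigma i j - sigma j i)
    (alpha : {lrmorphism {mpoly R[n]} -> {mpoly R[n]}}) :
  ((forall (r : nat) (I J : r.-tuple 'I_n) (f g : {mpoly R[n]}),
      alpha (mu_r I J f g) = mu_r I J (alpha f) (alpha g))
   /\ hom_associative (moyal_twist sigma alpha) (fps_ext1 alpha))
  <->
  exists b : 'I_n -> R,
    (forall i : 'I_n, alpha 'X_i = 'X_i + (b i)%:MP)
    \/ (forall i : 'I_n, alpha 'X_i = - 'X_i + (b i)%:MP).
Proof.
split=> [[alpha_mu _]|[b alphaX]]; first exact: mu_r_sign_affine.
have alpha_mu : forall r (I J : r.-tuple 'I_n) f g,
    alpha (mu_r I J f g) = mu_r I J (alpha f) (alpha g).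
  (* The two families are the cases [s = 1] and [s = -1]. *)
  case: alphaX => alphaX.
    apply: (@sign_affine_mu_r _ _ _ 1 b) => [|i]; first by rewrite mulr1.
    by rewrite scale1r.
  apply: (@sign_affine_mu_r _ _ _ (-1) b) => [|i]; first by rewrite mulrNN mulr1.
  by rewrite scaleN1r.
by split=> //; apply: hom_associative_moyal_twist.
Qed.
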